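(* For each positive integer $d$, there exists a constant $\gamma_d>0$ such that the following holds. If $A\subseteq\mathbb{R}^d$ is an $m$-element set with no linearly dependent $d$-element subsets, then $A$ has at least $\gamma_d m^{d+1}$ distinct subset sums.
   Context: A subset sum of a finite set $A\subseteq\mathbb{R}^d$ is a vector of the form $\sum_{v\in B}v$ with $B\subseteq A$ (the empty subset is allowed, giving the sum $0$). Linear dependence is over $\mathbb{R}$. The constant $\gamma_d$ depends only on $d$, not on $m$ or $A$. *)

(* Defs.v *)
From mathcomp Require Import all_boot all_order all_algebra.
From mathcomp Require Import finmap.
From mathcomp Require Import reals.

Set Implicit Arguments.
Unset Strict Implicit.
Unset Printing Implicit Defensive.

Import GRing.Theory.

Local Open Scope ring_scope.
Local Open Scope fset_scope.

Definition subset_sums (V : zmodType) (A : {fset V}) : {fset V} :=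
  [fset \sum_(v <- enum_fset B) v | B : {fset V} in fpowerset A].

(* The enumeration of a finite set has no repetitions, so freeness of the
   sequence is linear independence of the set. *)
Definition linearly_dependent (K : fieldType) (V : vectType K)
  (B : {fset V}) : bool := ~~ free (enum_fset B).

(* Main.v *)
(* Induction on d. Let v be in A and let S be the set of subset sums of A \ v.
   The subset sums of A contain S and S + v, and since S is finite, S + v leaves
   S on each line of direction v which meets S; so A has at least |S| + |f(S)|
   subset sums, where f is a projection with kernel the line of v. If f takes
   at least m/4 distinct values on A \ v, these values satisfy the hypothesis in
   dimension d - 1, so |f(S)| is at least of order m^d, and summing over the
   successive removals of elements gives m^(d+1). Such a v exists because a
   given pair of elements of A is collapsed by the projection along at most one
   v in A, no two elements of A being parallel. For d = 1, a generic linear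
   functional reduces to nonzero real numbers, half of which have the same sign.
   The dimension of the ambient space plays no role: only the size of the
   independent subsets changes in the induction. *)

Require Import Defs.
From mathcomp Require Import all_boot all_order all_algebra.
From mathcomp Require Import finmap.
From mathcomp Require Import reals.
From mathcomp Require Import zify lra.

Set Implicit Arguments.
Unset Strict Implicit.
Unset Printing Implicit Defensive.

Import Order.TTheory GRing.Theory Num.Theory.
Import VectorInternalTheory.

Local Open Scope ring_scope.
Local Open Scope fset_scope.

(** * Finite sets *)

Lemma perm_fsetD (T : choiceType) (A B : {fset T}) :
  B `<=` A -> perm_eq (enum_fset A) (enum_fset B ++ enum_fset (A `\` B)).
Proof.
move=> /fsubsetP sBA; apply: uniq_perm; rewrite ?fset_uniq ?cat_uniq //.
  rewrite !fset_uniq andbT /=; apply/hasPn => x; rewrite in_fsetD.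
  by case/andP.
by move=> x; rewrite mem_cat in_fsetD; case: (boolP (x \in B)) => [/sBA|].
Qed.

Lemma fset_extend (T : choiceType) (A B : {fset T}) (k : nat) :
    B `<=` A -> (#|` B| <= k <= #|` A|)%N ->
  exists C : {fset T}, [/\ B `<=` C, C `<=` A & #|` C| = k].
Proof.
move=> sBA /andP[leBk lekA].
set s := take (k - #|` B|) (enum_fset (A `\` B)).
have us : uniq s by rewrite take_uniq ?fset_uniq.
have sP x : x \in s -> x \in A `\` B by move/mem_take.
exists (B `|` [fset x in s]); split; first exact: fsubsetUl.
- rewrite fsubUset sBA; apply/fsubsetP => x; rewrite !inE => /sP.
  by rewrite in_fsetD => /andP[].
- rewrite cardfsU card_fseq (undup_id us) (_ : B `&` _ = fset0) ?cardfs0.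
    rewrite size_take -/(#|` A `\` B|) cardfsDS //.
    by case: ltnP => ?; lia.
  apply/fsetP => x; rewrite !inE; apply/negP => /andP[xB /sP].
  by rewrite in_fsetD xB.
Qed.

Lemma imfset_preim (K V : choiceType) (f : K -> V) (A : {fset K})
    (B : {fset V}) :
  B `<=` f @` A -> B = f @` [fset x in A | f x \in B].
Proof.
move=> sBA; apply/fsetP => z; apply/idP/imfsetP => [zB|[x]].
  have /imfsetP[x xA zE] := fsubsetP sBA _ zB.
  by exists x; rewrite // !inE /= xA -zE.
by rewrite !inE /= => /andP[_ ?] ->.
Qed.

(** * Subset sums and additive maps *)

Lemma subset_sumsP (V : zmodType) (A : {fset V}) (x : V) :
  reflect (exists2 B : {fset V}, B `<=` A & x = \sum_(v <- enum_fset B) v)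
          (x \in subset_sums A).
Proof.
apply: (iffP (imfsetP _ _ _ _)) => -[B sBA ->]; exists B => //.
  by rewrite -fpowersetE.
by rewrite /= fpowersetE.
Qed.

Lemma subset_sumsS (V : zmodType) (A B : {fset V}) :
  A `<=` B -> subset_sums A `<=` subset_sums B.
Proof.
move=> sAB; apply/fsubsetP => x /subset_sumsP[C sCA ->].
by apply/subset_sumsP; exists C => //; apply: fsubset_trans sAB.
Qed.

Lemma mem0_subset_sums (V : zmodType) (A : {fset V}) : 0 \in subset_sums A.
Proof.
by apply/subset_sumsP; exists fset0; rewrite ?fsub0set // big_seq_fset0.
Qed.

Lemma subset_sumsD1 (V : zmodType) (A : {fset V}) (v x : V) :
  v \in A -> x \in subset_sums (A `\ v) -> (v + x)%R \in subset_sums A.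
Proof.
move=> vA /subset_sumsP[B]; rewrite fsubsetD1 => /andP[sBA vB] ->.
apply/subset_sumsP; exists (v |` B); last by rewrite big_fsetU1.
by rewrite fsubUset fsub1set vA.
Qed.

Lemma subset_sums_imfset (U V : zmodType) (f : {additive U -> V})
    (A : {fset U}) :
  {in A &, injective f} -> subset_sums (f @` A) `<=` f @` subset_sums A.
Proof.
move=> f_inj; apply/fsubsetP => y /subset_sumsP[B sBA ->].
rewrite (imfset_preim sBA) big_imfset /=; last first.
  by move=> x y1; rewrite !inE => /andP[xA _] /andP[yA _]; apply: f_inj.
rewrite -raddf_sum; apply/imfsetP; eexists => //.
by apply/subset_sumsP; eexists; last by []; apply: fset_sub.
Qed.

Lemma leq_card_subset_sums_imfset (U V : zmodType) (f : {additive U -> V})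
    (A : {fset U}) :
  {in A &, injective f} ->
  (#|` subset_sums (f @` A)| <= #|` subset_sums A|)%N.
Proof.
move=> /subset_sums_imfset /fsubset_leq_card /leq_trans; apply.
exact: leq_imfset_card.
Qed.

(* [S + v] meets the complement of [S] on each line of direction [v] which
   meets [S], as [S] is finite; such a line is a fibre of [f]. *)
Lemma card_subset_sums_kernel (R : numFieldType) (V W : lmodType R)
    (f : {additive V -> W}) (A : {fset V}) (v : V) :
    v \in A -> v != 0 -> f v = 0 ->
  (#|` subset_sums (A `\ v)| + #|` f @` subset_sums (A `\ v)|
     <= #|` subset_sums A|)%N.
Proof.
move=> vA v0 fv0; set S := subset_sums (A `\ v).
pose N := [fset x in subset_sums A | x \notin S].
have sfSN : f @` S `<=` f @` N.
  apply/fsubsetP => _ /imfsetP[x0 /= x0S ->]; apply/negPn/negP => nfN.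
  pose F := [fset x in S | f x == f x0].
  (* If translation by [v] never leaves [S] on the fibre [F], it permutes [F]. Comparing the sums
     over [F] then gives [#|F|] times [v] equal to 0, so [F] is empty, although it contains [x0]. *)
  have FvF : (fun x => (v + x)%R) @` F = F.
    apply/eqP; rewrite eqEfcard (card_imfset _ _ (@addrI _ v)) leqnn andbT.
    apply/fsubsetP => _ /imfsetP[x + ->]; rewrite !inE => /andP[xS /eqP fx].
    rewrite raddfD fv0 add0r fx eqxx andbT.
    apply: contraNT nfN => nS; apply/imfsetP; exists (v + x)%R.
      by rewrite !inE /= nS subset_sumsD1.
    by rewrite raddfD fv0 add0r.
  have : \sum_(x <- enum_fset F) x = \sum_(x <- enum_fset F) (v + x).
    by rewrite -{1}FvF big_imfset //= => x y _ _ /addrI.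
  rewrite big_split /= -[LHS]add0r => /addIr /esym/eqP.
  rewrite big_const_seq count_predT iter_addr_0 -scaler_nat scaler_eq0.
  rewrite (negPf v0) orbF pnatr_eq0 cardfs_eq0 => /eqP F0.
  by have : x0 \in F; [rewrite !inE x0S eqxx | rewrite F0].
have sSA : S `<=` subset_sums A by apply/subset_sumsS/fsubD1set.
rewrite -(cardfsID S (subset_sums A)) (fsetIidPr sSA) leq_add2l.
have -> : subset_sums A `\` S = N by apply/fsetP => x; rewrite !inE andbC.
by apply: leq_trans (fsubset_leq_card sfSN) (leq_imfset_card _ _ _).
Qed.

(** * Nonzero scalars of an ordered domain *)

(** With [v] the maximum and [T] the sum of the other elements, every sum avoiding [v] is at most
    [T], while [v + T] and each [v + T - a], for [a] another element, exceed [T]. So the n-th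
    element in increasing order brings at least n new sums. *)
Lemma card_subset_sums_pos (R : realDomainType) (A : {fset R}) :
    {in A, forall x, 0 < x} ->
  (#|` A| ^ 2 <= 2 * #|` subset_sums A|)%N.
Proof.
move nE: #|` A| => n; elim: n => // n IHn in A nE * => A_gt0.
have [v vA v_max] : exists2 v, v \in A & {in A, forall x, x <= v}.
  have /fset0Pn[a aA] : A != fset0 by rewrite -cardfs_gt0 nE.
  have [i _ imax] := @Order.TotalTheory.arg_maxP _ _ _ [` aA] xpredT val isT.
  by exists (val i) => [|x xA]; [apply: valP|apply: (imax [` xA])].
set A' := A `\ v.
have A'P x : x \in A' -> [/\ x \in A, 0 < x & x < v].
  by rewrite in_fsetD1 => /andP[xv xA]; rewrite A_gt0 ?lt_neqAle ?xv ?v_max.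
have A'0 : 0 \notin A' by apply/negP => /A'P[]; rewrite ltxx.
have A'n : #|` A'| = n by move: nE; rewrite (cardfsD1 v) vA => -[].
have {}IHn : (n ^ 2 <= 2 * #|` subset_sums A'|)%N.
  by apply: IHn => // x /A'P[].
pose T := \sum_(x <- enum_fset A') x.
have TA : \sum_(x <- enum_fset A) x = (v + T)%R by rewrite (big_fsetD1 v).
(* The index [0] gives the full sum [v + T]; as [0] is not in [A'], it adds one to the count. *)
pose D := [fset (v + T - x)%R | x in 0 |` A'].
have cD : #|` D| = n.+1.
  rewrite card_imfset => [|x y /addrI /oppr_inj //].
  by rewrite /= cardfsU1 A'0 A'n.
have sDA : D `<=` subset_sums A.
  apply/fsubsetP => _ /imfsetP[a + ->]; rewrite -TA in_fset1U => /orP[/eqP->|].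
    by rewrite subr0; apply/subset_sumsP; exists A.
  move/A'P=> [aA _ _]; apply/subset_sumsP; exists (A `\ a).
    exact: fsubD1set.
  by rewrite (big_fsetD1 a aA) /= addrAC subrr add0r.
have S_le x : x \in subset_sums A' -> x <= T.
  case/subset_sumsP => B sBA' ->; rewrite /T (perm_big _ (perm_fsetD sBA')).
  rewrite big_cat /= lerDl big_seq sumr_ge0 // => y; rewrite in_fsetD.
  by case/andP=> _ /A'P[_ /ltW].
have D_gt x : x \in D -> T < x.
  case/imfsetP=> a + ->; rewrite addrAC ltrDr subr_gt0 in_fset1U.
  by case/orP=> [/eqP->|/A'P[]//]; apply: A_gt0.
have sSDA : subset_sums A' `|` D `<=` subset_sums A.
  by rewrite fsubUset sDA andbT; apply/subset_sumsS/fsubD1set.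
have := fsubset_leq_card sSDA.
rewrite cardfsU (_ : _ `&` D = fset0) ?cardfs0 ?subn0 ?cD.
  by move: IHn; rewrite -!mulnn; nia.
apply/fsetP => x; rewrite !inE; apply/negP => /andP[/S_le xT /D_gt].
by rewrite ltNge xT.
Qed.

(** Negation turns the negative elements into positive ones, and [(p + n)^2 <= 2 (p^2 + n^2)]
    combines the bounds for the two signs. *)
Lemma card_subset_sums_neq0 (R : realDomainType) (A : {fset R}) :
  0 \notin A -> (#|` A| ^ 2 <= 8 * #|` subset_sums A|)%N.
Proof.
move=> A0; pose P := [fset x in A | 0 < x]; pose N := [fset x in A | x < 0].
have cP : (#|` P| ^ 2 <= 2 * #|` subset_sums A|)%N.
  have/card_subset_sums_pos/leq_trans: {in P, forall x, 0 < x}.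
    by move=> x; rewrite !inE => /andP[].
  by apply; rewrite leq_mul2l /=; apply/fsubset_leq_card/subset_sumsS/fset_sub.
have cN : (#|` N| ^ 2 <= 2 * #|` subset_sums A|)%N.
  pose N' := -%R @` N.
  have <- : #|` N'| = #|` N| by rewrite card_imfset //; apply: oppr_inj.
  have/card_subset_sums_pos/leq_trans: {in N', forall x, 0 < x}.
    by move=> _ /imfsetP[x + ->]; rewrite !inE oppr_gt0 => /andP[].
  apply; rewrite leq_mul2l /=.
  apply: (@leq_trans #|` subset_sums N|); last first.
    exact/fsubset_leq_card/subset_sumsS/fset_sub.
  by apply: leq_card_subset_sums_imfset => x y _ _ /oppr_inj.
have APN : A = P `|` N.
  apply/fsetP => x; rewrite !inE -andb_orr; case: (boolP (x \in A)) => //= xA.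
  by rewrite -neq_lt eq_sym (memPn A0).
have : (#|` A| <= #|` P| + #|` N|)%N by rewrite {1}APN cardfsU leq_subr.
move=> le_PN; apply: leq_trans (leq_mul le_PN le_PN) _.
by have := nat_Cauchy #|` P| #|` N|; move: cP cN; rewrite -!mulnn; nia.
Qed.

(** * Generic functionals and rich directions *)

(** The integers below [size p] are distinct in characteristic zero, and there are more of them than
    [p] can have roots. *)
Lemma poly_nonroot (R : numDomainType) (p : {poly R}) :
  p != 0 -> exists t, p.[t] != 0.
Proof.
move=> p0; pose s : seq R := [seq i%:R | i <- iota 0 (size p)].
have us : uniq s.
  by rewrite map_inj_uniq ?iota_uniq // => i j /eqP; rewrite eqr_nat => /eqP.
have : ~~ all (root p) s.
  apply/negP => /(max_poly_roots p0)/(_ us).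
  by rewrite size_map size_iota ltnn.
by case/allPn => t _ nr; exists t.
Qed.

(* Evaluating at a generic [t] the polynomial whose coefficients are the
   coordinates of the vector. *)
Lemma generic_functional (R : numFieldType) (V : vectType R) (s : seq V) :
  0 \notin s -> exists f : {additive V -> R}, {in s, forall x, f x != 0}.
Proof.
move=> s0; pose q (x : V) := rVpoly (v2r x).
have q_eq0 x : (q x == 0) = (x == 0).
  apply/eqP/eqP => [q0|->]; last by rewrite /q !linear0.
  by apply/v2r_inj/(can_inj rVpolyK); rewrite !linear0.
  (* A nonroot of the product serves all vectors of [s] at once. *)
  have : \prod_(x <- s) q x != 0.
  rewrite prodf_seq_neq0; apply/allP => x xs /=.
  by rewrite q_eq0 (memPn s0).
case/poly_nonroot => t; rewrite horner_prod prodf_seq_neq0 => /allP qt.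
exists (horner_eval t \o rVpoly \o v2r : {additive V -> R}) => x /qt.
by [].
Qed.

(** With [0] adjoined to [A], nonvanishing on all nonzero differences yields both injectivity and
    nonzero values. *)
Lemma generic_functional_inj (R : numFieldType) (V : vectType R)
    (A : {fset V}) : 0 \notin A ->
  exists2 f : {additive V -> R}, {in A &, injective f} & 0 \notin f @` A.
Proof.
move=> A0; pose B := 0 |` A.
pose s := [seq z <- [seq x - y | x <- enum_fset B, y <- enum_fset B] | z != 0].
have /generic_functional[f fP] : 0 \notin s by rewrite mem_filter eqxx.
have f_inj : {in B &, injective f}.
  move=> x y xB yB /eqP; rewrite -subr_eq0 -raddfB => fxy.
  apply/eqP; rewrite -subr_eq0; apply: contraTT fxy => xy.
  by apply: fP; rewrite mem_filter xy; apply: allpairs_f.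
exists f => [x y xA yA|]; first by apply: f_inj; rewrite !inE ?xA ?yA orbT.
apply/imfsetP => -[x xA]; rewrite -{1}[0](raddf0 f) => /f_inj.
by move=> E; move: A0; rewrite E ?xA // !inE ?eqxx ?xA ?orbT.
Qed.

(* For [i < j] at most one [v] in [A] is parallel to the difference of the
   [i]-th and [j]-th elements of [A], so on average over [v] at most half of
   the [j] are congruent modulo [v] to an earlier element. *)
Lemma exists_rich_direction (K : fieldType) (V : vectType K) (A : {fset V}) :
    A != fset0 ->
    {in A &, forall x y, x != y -> x \notin <[y]>%VS} ->
  exists v (C : {fset V}), [/\ v \in A, C `<=` A `\ v,
    (#|` A| <= 2 * #|` C| + 1)%N &
    {in C &, forall x y, (x - y)%R \in <[v]>%VS -> x = y}].
Proof.
rewrite -cardfs_gt0 => A_gt0 A_par.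
set m := #|` A| in A_gt0 *; pose a (i : 'I_m) := (enum_fset A)`_i.
have aA i : a i \in A by apply: mem_nth; rewrite -/m.
have a_inj : injective a.
  by move=> i j /eqP; rewrite nth_uniq ?fset_uniq //= => /eqP/val_inj.
pose dir (v i j : 'I_m) := (i < j)%N && (a j - a i \in <[a v]>)%VS.
have dir_le1 i j : (\sum_v dir v i j <= (i < j)%N)%N.
  have [ltij|leji] := boolP (i < j)%N; last first.
    by rewrite big1 // => v _; rewrite /dir (negPf leji).
  case: (pickP (fun v => dir v i j)) => [v dv|no]; last first.
    by rewrite big1 // => v; rewrite no.
  rewrite (bigD1 v) //= dv big1 // => w wv; case dw: (dir w i j) => //.
  case/andP: dv dw => _ /vlineP[c cE] /andP[_].
  have c0 : c != 0.
    apply: contraTneq ltij => c0; move/eqP: cE; rewrite c0 scale0r subr_eq0.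
    by move=> /eqP/a_inj ->; rewrite ltnn.
  rewrite cE => /(memvZ c^-1); rewrite scalerA mulVf // scale1r => aw.
  have := A_par _ _ (aA v) (aA w); rewrite (inj_eq a_inj) eq_sym aw.
  by move=> /(_ wv).
pose bad v j := [exists i, dir v i j].
(* Otherwise each [v] has at least [m / 2] bad indices, and twice their total is at least [m * m];
   but the pairs [i < j] allow only [m * m.-1]. *)
have [v v_bad] : exists v, (2 * #|[set j | bad v j]| <= m.-1)%N.
  apply/existsP; rewrite -[X in is_true X]negbK negb_exists.
  apply/negP => /forallP m_le.
  have : (m * m <= \sum_v 2 * #|[set j | bad v j]|)%N.
    rewrite -[X in (X * _)%N]card_ord -sum_nat_const leq_sum // => v _.
    by move: (m_le v); rewrite -ltnNge; lia.
  rewrite -big_distrr /= leqNgt => /negP; apply.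
  have bad_le v : (#|[set j | bad v j]| <= \sum_j \sum_i dir v i j)%N.
    rewrite -sum1dep_card big_mkcond leq_sum //= => j _.
    case: (boolP (bad v j)) => // /existsP[i dij]; by rewrite (bigD1 i) //= dij.
  have : (\sum_v #|[set j | bad v j]| <= \sum_(j < m) j)%N.
    apply: (@leq_trans (\sum_v \sum_j \sum_i dir v i j)).
      by apply: leq_sum => v _; apply: bad_le.
    rewrite exchange_big leq_sum //= => j _; rewrite exchange_big /=.
    apply: (@leq_trans (\sum_(i < m) (i < j)%N)).
      by apply: leq_sum => i _; apply: dir_le1.
    have -> : (\sum_(i < m) (i < j)%N = \sum_(i < m | (i < j)%N) 1)%N.
      by rewrite [RHS]big_mkcond; apply: eq_bigr => i _; case: ltnP.
    rewrite -(big_ord_widen m (fun=> 1%N)) ?sum1_card ?card_ord //.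
    exact: ltnW.
  have : (2 * \sum_(j < m) j = m * m.-1)%N.
    by rewrite -(big_mkord xpredT id) /= bin2_sum -mul_bin_diag bin1.
  move=> E le; apply: leq_ltn_trans (leq_mul (leqnn 2) le) _.
  by rewrite E ltn_pmul2l // prednK.
(* Of two indices congruent modulo [a v] the larger is bad, so [G] has no such pair. Excluding [v]
   itself costs the [+ 1] in the count. *)
pose G := [set j | ~~ bad v j & j != v].
pose C := [fset a j | j in G].
exists (a v), C; split=> //.
- apply/fsubsetP => _ /imfsetP[j + ->]; rewrite /= inE => /andP[_ jv].
  by rewrite in_fsetD1 aA andbT (inj_eq a_inj).
- rewrite card_imfset //= -cardE.
  have : (m <= #|[set j | bad v j] :|: [set v]| + #|G|)%N.
    rewrite -[X in (X <= _)%N]card_ord.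
    rewrite -(cardsC ([set j | bad v j] :|: [set v])) leq_add2l.
    by apply/subset_leq_card/subsetP => j; rewrite !inE negb_or.
  rewrite cardsU cards1; lia.
- have good (i j : 'I_m) :
      ~~ bad v j -> (i < j)%N -> ((a j - a i)%R \in <[a v]>)%VS -> False.
    by move=> + ij aij => /existsP[]; exists i; rewrite /dir ij.
  move=> _ _ /imfsetP[i + ->] /imfsetP[j + ->]; rewrite !inE.
  move=> /andP[gi _] /andP[gj _] aij.
  case: (ltngtP i j) => [ij|ji|/val_inj->//]; exfalso.
    by apply: (good i j) => //; rewrite -opprB memvN.
  exact: (good j i).
Qed.

(** * Linear independence and general position under projection *)

Lemma free_subfset (K : fieldType) (V : vectType K) (A B : {fset V}) :
  B `<=` A -> free (enum_fset A) -> free (enum_fset B).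
Proof. by move=> /perm_fsetD /perm_free ->; apply: catl_free. Qed.

Lemma free_fset1U (K : fieldType) (V : vectType K) (v : V) (B : {fset V}) :
    v \notin B ->
  free (enum_fset (v |` B)) =
  (v \notin <<enum_fset B>>)%VS && free (enum_fset B).
Proof.
move=> vB; rewrite -free_cons; apply/perm_free/uniq_perm.
- exact: fset_uniq.
- by rewrite /= vB fset_uniq.
- by move=> x; rewrite in_fset1U inE.
Qed.

(** Independence of [v] from [B] makes the span of [B] meet the kernel trivially, so [f] is
    injective on that span. *)
Lemma free_imfset (K : fieldType) (V W : vectType K) (f : 'Hom(V, W)) (v : V)
    (B : {fset V}) : lker f = <[v]>%VS -> v \notin B ->
    {in B &, injective f} -> free (enum_fset (v |` B)) ->
  free (enum_fset (f @` B)).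
Proof.
move=> kerf vB f_inj; rewrite free_fset1U // => /andP[v_span freeB].
have cap0 : (<<enum_fset B>> :&: lker f = 0)%VS.
  apply/eqP; rewrite -subv0; apply/subvP => x; rewrite memv_cap kerf memv0.
  case/andP=> + /vlineP[c xE]; rewrite xE => cv.
  apply: contraNT v_span; rewrite scaler_eq0 negb_or => /andP[c0 _].
  by rewrite -[v]scale1r -(mulVf c0) -scalerA memvZ.
have /basis_free : basis_of (f @: <<enum_fset B>>) (map f (enum_fset B)).
  by apply: limg_basis_of => //; rewrite /basis_of eqxx.
rewrite (@perm_free _ _ _ (enum_fset (f @` B))) //; apply: uniq_perm.
- by rewrite map_inj_in_uniq ?fset_uniq.
- exact: fset_uniq.
- by move=> y; apply/mapP/imfsetP.
Qed.

Lemma exists_lker_vline (K : fieldType) (V : vectType K) (v : V) :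
  exists f : 'End(V), lker f = <[v]>%VS.
Proof.
exists (\1 - projv <[v]>)%VF; apply/vspaceP => x.
rewrite memv_ker !lfunE /= lfunE /= opp_lfunE subr_eq0.
by apply/eqP/idP => [->|/projv_id->//]; apply: memv_proj.
Qed.

(** The size [k] is separate from the dimension of [V], so a projection can lower [k] inside the
    same space. The condition is vacuous when [A] has fewer than [k] elements. *)
Definition general_position (K : fieldType) (V : vectType K) (k : nat)
    (A : {fset V}) :=
  forall B : {fset V}, B `<=` A -> #|` B| = k -> free (enum_fset B).

Lemma general_positionS (K : fieldType) (V : vectType K) (k : nat)
    (A B : {fset V}) :
  B `<=` A -> general_position k A -> general_position k B.
Proof. by move=> sBA gA C sCB; apply/gA/(fsubset_trans sCB). Qed.

Lemma general_position_free (K : fieldType) (V : vectType K) (k : nat)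
    (A B : {fset V}) : general_position k A -> (k <= #|` A|)%N ->
  B `<=` A -> (#|` B| <= k)%N -> free (enum_fset B).
Proof.
move=> gA lekA sBA leBk.
have [|C [sBC sCA cC]] := fset_extend (k := k) sBA; first by rewrite leBk.
exact: free_subfset sBC (gA _ sCA cC).
Qed.

Lemma general_position_neq0 (K : fieldType) (V : vectType K) (k : nat)
    (A : {fset V}) : (0 < k <= #|` A|)%N -> general_position k A -> 0 \notin A.
Proof.
case/andP=> k_gt0 lekA gA; apply/negP => A0.
have : free (enum_fset [fset (0 : V)]).
  by apply: general_position_free gA lekA _ _; rewrite ?fsub1set ?cardfs1.
by move/free_not0 => /(_ 0); rewrite inE eqxx => /(_ isT).
Qed.

Lemma general_position_npar (K : fieldType) (V : vectType K) (k : nat)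
    (A : {fset V}) : (1 < k <= #|` A|)%N -> general_position k A ->
  {in A &, forall x y, x != y -> x \notin <[y]>%VS}.
Proof.
case/andP=> k_gt1 lekA gA x y xA yA xy.
have : free (enum_fset (x |` [fset y])).
  apply: general_position_free gA lekA _ _.
    by rewrite fsubUset !fsub1set xA.
  by rewrite cardfs2 xy.
rewrite free_fset1U ?inE // => /andP[+ _].
apply: contra => /vlineP[c ->]; apply/memvZ/memv_span.
by rewrite inE.
Qed.

(** A [k]-element subset of the image lifts to [C]; adjoining [v] makes it an independent set of
    size [k.+1], to which [free_imfset] applies. *)
Lemma general_position_proj (K : fieldType) (V W : vectType K) (k : nat)
    (A C : {fset V}) (v : V) (f : 'Hom(V, W)) :
    general_position k.+1 A -> v \in A -> C `<=` A `\ v -> lker f = <[v]>%VS ->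
    {in C &, injective f} ->
  general_position k (f @` C).
Proof.
move=> gA vA; rewrite fsubsetD1 => /andP[sCA vC] kerf f_inj B sBC cB.
pose B' := [fset x in C | f x \in B].
have sB'C : B' `<=` C by apply: fset_sub.
have BE : B = f @` B' := imfset_preim sBC.
have f_inj' : {in B' &, injective f}.
  by move=> x y /(fsubsetP sB'C) xC /(fsubsetP sB'C) yC; apply: f_inj.
have vB' : v \notin B' by apply: contra vC => /(fsubsetP sB'C).
rewrite BE; apply: (free_imfset kerf) => //; apply: gA.
  by rewrite fsubUset fsub1set vA (fsubset_trans sB'C).
by rewrite cardfsU1 vB' -cB [in RHS]BE [in RHS]card_in_imfset.
Qed.

(** * Induction on the size of the independent subsets *)

Definition subset_sums_bound (R : realFieldType) (k : nat) (gamma : R) :=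
  forall (V : vectType R) (A : {fset V}), general_position k A ->
    gamma * #|` A|%:R ^+ k.+1 <= #|` subset_sums A|%:R.

Lemma subset_sums_bound1 (R : realFieldType) : subset_sums_bound 1 (8^-1 : R).
Proof.
move=> V A gA; have [->|] := eqVneq A fset0.
  by rewrite cardfs0 expr0n mulr0.
rewrite -cardfs_gt0 => A_gt0.
have [f f_inj f0] :=
  generic_functional_inj (@general_position_neq0 _ _ 1 A A_gt0 gA).
rewrite mulrC ler_pdivrMr // -natrX -natrM ler_nat mulnC.
have <- : #|` f @` A| = #|` A| by rewrite card_in_imfset.
apply: leq_trans (card_subset_sums_neq0 f0) _.
by rewrite leq_mul2l leq_card_subset_sums_imfset.
Qed.

(** This mean value estimate bounds how much the target grows when one element is added to [A]. *)
Lemma exprD1_le (R : realDomainType) (x : R) (n : nat) : 0 <= x ->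
  (x + 1)%R ^+ n.+1 <= (x ^+ n.+1 + n.+1%:R * (x + 1) ^+ n)%R.
Proof.
move=> x0; elim: n => [|n IHn]; first by rewrite !expr1 expr0 mulr1.
rewrite [leLHS]exprS; apply: le_trans (ler_wpM2l _ IHn) _; first lra.
have : x ^+ n.+1 <= (x + 1)%R ^+ n.+1 by rewrite lerXn2r ?nnegrE; lra.
rewrite mulrDr mulrDl -exprS mul1r mulrCA -exprS -(natr1 n.+1) mulrDl mul1r.
lra.
Qed.

Lemma subset_sums_boundS (R : realFieldType) (k : nat) (gamma : R) :
    (0 < k)%N -> 0 < gamma -> subset_sums_bound k gamma ->
  exists2 gamma' : R, 0 < gamma' & subset_sums_bound k.+1 gamma'.
Proof.
move=> k_gt0 gamma_gt0 bound_k.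
(* The first term lets the gain [gamma * ((m + 1) / 4) ^+ k.+1] cover the growth
   [gamma' * k.+2 * (m + 1) ^+ k.+1] of the target. The second makes the target at most 1 for sets
   of at most [k] elements, where the empty sum suffices. *)
pose gamma' := Num.min (gamma / 4 ^+ k.+1 / k.+2%:R) (k.+1%:R ^- k.+2).
have gamma'_gt0 : 0 < gamma'.
  by rewrite lt_min !divr_gt0 ?invr_gt0 ?exprn_gt0 ?ltr0n.
exists gamma' => // V A; move mE: #|` A| => m; elim: m => [|m IHm] in A mE *.
  by rewrite expr0n mulr0.
move=> gA; have [lemk|ltkm] := leqP m.+1 k.
  apply: (@le_trans _ _ 1); last first.
    by rewrite ler1n cardfs_gt0; apply/fset0Pn; exists 0;
       apply: mem0_subset_sums.
  rewrite -ler_pdivlMr ?exprn_gt0 ?ltr0n // mul1r.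
  apply: (@le_trans _ _ (k.+1%:R ^- k.+2)); first by rewrite ge_min lexx orbT.
  rewrite lef_pV2 ?posrE ?exprn_gt0 ?ltr0n // lerXn2r ?nnegrE ?ler0n // ler_nat.
  exact: leqW.
have A_big : (1 < k.+1 <= #|` A|)%N by rewrite mE ltnS k_gt0.
have [|v [C [vA sCA cC C_inj]]] := exists_rich_direction _
    (general_position_npar A_big gA); first by rewrite -cardfs_gt0 mE.
have v0 : v != 0.
  by apply: contraTneq vA => ->; apply: general_position_neq0 gA; rewrite mE.
have [f kerf] := exists_lker_vline v.
have fv0 : f v = 0 by apply/eqP; rewrite -memv_ker kerf memv_line.
have f_inj : {in C &, injective f}.
  move=> x y xC yC /eqP; rewrite -subr_eq0 -linearB -memv_ker kerf.
  exact: C_inj.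
have := bound_k _ _ (general_position_proj gA vA sCA kerf f_inj).
rewrite card_in_imfset //= => boundC.
have cA' : #|` A `\ v| = m by move: mE; rewrite (cardfsD1 v) vA => -[].
have boundA' := IHm _ cA' (general_positionS (fsubD1set _ _) gA).
have := card_subset_sums_kernel (f := f) vA v0 fv0.
have : (#|` subset_sums (f @` C)| <= #|` f @` subset_sums (A `\ v)|)%N.
  apply/fsubset_leq_card/(fsubset_trans (subset_sums_imfset f_inj)).
  apply: subset_imfset; apply/fsubsetP; exact: subset_sumsS.
move=> /(leq_add (leqnn _)) /leq_trans h /h {h}.
rewrite -(ler_nat R) natrD; apply: le_trans.
apply: le_trans (lerD boundA' boundC).
rewrite -natr1.
apply: le_trans (ler_wpM2l (ltW gamma'_gt0) (exprD1_le _ _)) _ => //.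
rewrite mulrDr lerD2l mulrA.
apply: (@le_trans _ _ (gamma / 4 ^+ k.+1 * (m%:R + 1)%R ^+ k.+1)).
  rewrite ler_wpM2r ?exprn_ge0 ?addr_ge0 //.
  by rewrite -ler_pdivlMr ?ltr0n // ge_min lexx.
rewrite -mulrA ler_pM2l // -exprVn -exprMn lerXn2r ?nnegrE //.
  by rewrite mulr_ge0 ?invr_ge0 ?addr_ge0.
(* Here [m.+1 <= 2 * #|C| + 1] and [1 <= k <= m] give [m.+1 <= 4 * #|C|], the source of the 4 in
   [gamma']. *)
rewrite mulrC ler_pdivrMr // natr1 -natrM ler_nat; move: cC; rewrite mE.
have := leq_trans k_gt0 ltkm.
by move: #|` C| => c; lia.
Qed.

Theorem theorem1p2 (R : realType) (d : nat) (d_gt0 : (0 < d)%N) :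
  exists2 gamma : R, 0 < gamma &
    forall (m : nat) (A : {fset 'rV[R]_d}),
      #|` A| = m ->
      (forall B : {fset 'rV[R]_d},
          B `<=` A -> #|` B| = d -> ~~ linearly_dependent B) ->
      gamma * m%:R ^+ d.+1 <= (#|` subset_sums A|)%:R.
Proof.
have [gamma gamma_gt0 bound_d] :
    exists2 gamma : R, 0 < gamma & subset_sums_bound d gamma.
  elim: d d_gt0 => // -[_ _|d IHd _].
    by exists 8^-1; [rewrite invr_gt0 | apply: subset_sums_bound1].
  by have [//|gamma ? ?] := IHd; apply: (@subset_sums_boundS _ d.+1 gamma).
exists gamma => // m A <- gA; apply: bound_d => B sBA cB.
by apply/negPn/gA.
Qed.
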